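(* Assume that the billiard map inside a tetrahedron $ABCD$ is coded by the letters $a,b,c,d$, where $a$ (resp. $b,c,d$) is the face opposite to the vertex $A$ (resp. $B,C,D$). (i) There is a neighbourhood of the regular tetrahedron (in the space of tetrahedra) such that for every tetrahedron in this neighbourhood the word $abcd$ is periodic (a periodic orbit with this code is called Fagnano's orbit). (ii) In any right tetrahedron, Fagnano's orbit does not exist (i.e. the word $abcd$ is not periodic). Moreover, there exists a nonempty open set of obtuse tetrahedra in which Fagnano's orbit does not exist.
   Context: Billiard map. Let $P$ be a polyhedron in $\mathbb{R}^3$. The billiard map $T$ sends $(m,\theta)$, with $m\in\partial P$ and $\theta$ a unit vector of $\mathbb{R}^3$ (pointing into $P$), to $(m',\theta')$, where $m'$ is the next point of $\partial P$ met by the half-line from $m$ in direction $\theta$, and $\theta'=S\theta$ with $S$ the linear reflection over the face containing $m'$. $T$ is not defined if the trajectory meets an edge; directions contained in faces are not considered. The coding of $(m,\theta)$ is the sequence of labels of the faces containing $m$ and the base points of its successive images under $T$. The word $abcd$ is periodic in a tetrahedron if there is a point $(m,\theta)$ with $T^4(m,\theta)=(m,\theta)$ whose coding begins with $abcd$. The space of tetrahedra is topologized by the coordinates of the vertices. A tetrahedron is acute if and only if, for each face, the orthogonal projection of the remaining vertex on the plane of this face lies inside the triangle. A tetrahedron is right if and only if there exists a vertex at which the three faces meeting there are right triangles with their right angle at this vertex. A tetrahedron is obtuse if it is neither acute nor right. *)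

(* Defs.v *)
From mathcomp Require Import all_boot all_order all_algebra.
From mathcomp Require Import all_classical all_reals all_analysis.
Import Order.TTheory GRing.Theory Num.Theory.
Import numFieldNormedType.Exports.

Set Implicit Arguments.
Unset Strict Implicit.
Unset Printing Implicit Defensive.

Local Open Scope classical_set_scope.
Local Open Scope ring_scope.

(* The norm `|u| of the library on 'rV[R]_3 is the sup norm; it induces the
   usual topology, but lengths and angles need the Euclidean structure. *)
Definition dot (R : realType) (u v : 'rV[R]_3) : R := \sum_i u 0 i * v 0 i.

Definition enorm (R : realType) (u : 'rV[R]_3) : R := Num.sqrt (dot u u).

(* Four points of R^3, with vertices A, B, C, D, are stored as the rows
   0, 1, 2, 3 of a 4 x 3 matrix; the space of such configurations has the
   topology of the vertex coordinates. *)
Notation quadruple R := 'M[R]_(4, 3).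

Definition vertex (R : realType) (V : quadruple R) (i : 'I_4) : 'rV[R]_3 :=
  row i V.

Definition combination (R : realType) (V : quadruple R) (w : 'I_4 -> R) :
  'rV[R]_3 := \sum_i w i *: vertex V i.

Definition affine_weights (R : realType) (J : pred 'I_4) (w : 'I_4 -> R) :=
  \sum_i w i = 1 /\ forall i, ~~ J i -> w i = 0.

Definition affine_span (R : realType) (V : quadruple R) (J : pred 'I_4) :
    set 'rV[R]_3 :=
  [set m | exists2 w, affine_weights J w & m = combination V w].

Definition convex_hull (R : realType) (V : quadruple R) (J : pred 'I_4) :
    set 'rV[R]_3 :=
  [set m | exists w, [/\ affine_weights J w, forall i, 0 <= w i &
                         m = combination V w]].

(* Relative interior of the simplex spanned by the vertices in J. *)
Definition open_simplex (R : realType) (V : quadruple R) (J : pred 'I_4) :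
    set 'rV[R]_3 :=
  [set m | exists w, [/\ affine_weights J w, forall i, J i -> 0 < w i &
                         m = combination V w]].

(* Affine independence of the four vertices. *)
Definition tetrahedron (R : realType) (V : quadruple R) : Prop :=
  forall w : 'I_4 -> R,
    \sum_i w i = 0 -> combination V w = 0 -> forall i, w i = 0.

Definition regular (R : realType) (V : quadruple R) : Prop :=
  tetrahedron V /\
  forall i j k l, i != j -> k != l ->
    enorm (vertex V i - vertex V j) = enorm (vertex V k - vertex V l).

Definition solid (R : realType) (V : quadruple R) : set 'rV[R]_3 :=
  convex_hull V predT.

(* Faces are labelled by the opposite vertex. *)
Definition face (R : realType) (V : quadruple R) (i : 'I_4) : set 'rV[R]_3 :=
  convex_hull V (predC1 i).

Definition edges (R : realType) (V : quadruple R) : set 'rV[R]_3 :=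
  [set m | exists i j, i != j /\ convex_hull V (pred2 i j) m].

Definition boundary (R : realType) (V : quadruple R) : set 'rV[R]_3 :=
  closure (solid V) `\` interior (solid V).

Definition orthogonal_to_face (R : realType) (V : quadruple R) (i : 'I_4)
    (u : 'rV[R]_3) : Prop :=
  forall j k, j != i -> k != i -> dot u (vertex V j - vertex V k) = 0.

Definition vertex_projection (R : realType) (V : quadruple R) (i : 'I_4)
    (p : 'rV[R]_3) : Prop :=
  affine_span V (predC1 i) p /\ orthogonal_to_face V i (vertex V i - p).

(* The projections must lie strictly inside the faces: with closed faces, right
   tetrahedra would be acute as well. *)
Definition acute (R : realType) (V : quadruple R) : Prop :=
  forall i, exists2 p, vertex_projection V i p & open_simplex V (predC1 i) p.

Definition right_tetrahedron (R : realType) (V : quadruple R) : Prop :=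
  exists i, forall j k, j != i -> k != i -> j != k ->
    dot (vertex V j - vertex V i) (vertex V k - vertex V i) = 0.

Definition obtuse (R : realType) (V : quadruple R) : Prop :=
  ~ acute V /\ ~ right_tetrahedron V.

(* v is the image of u by the linear reflection over the direction plane of
   face i; the normal n is determined up to a scalar, on which the formula does
   not depend. *)
Definition reflected (R : realType) (V : quadruple R) (i : 'I_4)
    (u v : 'rV[R]_3) : Prop :=
  exists n, [/\ n != 0, orthogonal_to_face V i n &
                v = u - (2 * dot u n / dot n n) *: n].

Notation phase R := ('rV[R]_3 * 'rV[R]_3)%type.

(* In particular the direction is not contained in a face through m. *)
Definition points_into (R : realType) (V : quadruple R) (m u : 'rV[R]_3) :
    Prop :=
  exists2 e : R, 0 < e &
    forall s, 0 < s < e -> interior (solid V) (m + s *: u).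

Definition next_boundary_point (R : realType) (V : quadruple R)
    (m u m' : 'rV[R]_3) : Prop :=
  exists t : R, [/\ 0 < t, m' = m + t *: u, boundary V m' &
                    forall s, 0 < s < t -> ~ boundary V (m + s *: u)].

(* Graph of the partial map T. The face i below is unique, since m' is on no
   edge. *)
Definition billiard_map (R : realType) (V : quadruple R) (x x' : phase R) :
    Prop :=
  let: (m, u) := x in let: (m', u') := x' in
  [/\ [/\ boundary V m, enorm u = 1 & points_into V m u],
      next_boundary_point V m u m',
      ~ edges V m /\ ~ edges V m' &
      exists2 i, face V i m' & reflected V i u u'].

Fixpoint billiard_iter (R : realType) (V : quadruple R) (n : nat)
    (x y : phase R) : Prop :=
  if n is n'.+1 then
    exists2 z, billiard_map V x z & billiard_iter V n' z y
  else x = y.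

(* i is the k-th letter of the coding of x. *)
Definition coding (R : realType) (V : quadruple R) (x : phase R) (k : nat)
    (i : 'I_4) : Prop :=
  exists2 y, billiard_iter V k x y & face V i y.1.

Definition periodic_word (R : realType) (V : quadruple R) (w : seq 'I_4) :
    Prop :=
  exists2 x, billiard_iter V (size w) x x &
    forall k, (k < size w)%N -> coding V x k (nth ord0 w k).

Definition face_a : 'I_4 := @Ordinal 4 0 isT.
Definition face_b : 'I_4 := @Ordinal 4 1 isT.
Definition face_c : 'I_4 := @Ordinal 4 2 isT.
Definition face_d : 'I_4 := @Ordinal 4 3 isT.

Definition word_abcd : seq 'I_4 := [:: face_a; face_b; face_c; face_d].

(* Main.v *)
(** In barycentric coordinates everything depends on the Gram matrix G of the
    gradients g_k of the four coordinates, whose sum is zero. Along an orbit coded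
    abcd, the k-th reflection adds a multiple of g_k to the direction; after one
    period these multiples combine the g_k to zero, hence are all equal. So the
    directions are determined up to scale, and the projection on g_k of the fact
    that the orbit closes up is a linear equation in the times of flight, with
    coefficients in G. Conversely, positive times solving these four equations
    give barycentric coordinates for the bounces, hence an orbit if those are
    positive. Cramer's rule gives times that are rational in the vertices and
    positive at a regular tetrahedron, hence nearby. In a right tetrahedron two of
    the equations force one time to vanish; if the dihedral angle between b and c
    is obtuse and a further open condition holds, a combination of the equations
    at b and c has only positive coefficients. *)
Require Import Defs.
From mathcomp Require Import all_boot all_order all_algebra.
From mathcomp Require Import all_classical all_reals all_analysis.
From mathcomp Require Import ring lra.
Import Order.TTheory GRing.Theory Num.Theory.
Import numFieldNormedType.Exports.
Local Open Scope classical_set_scope.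
Local Open Scope ring_scope.

Set Implicit Arguments.
Unset Strict Implicit.
Unset Printing Implicit Defensive.

(** * Barycentric coordinates *)

Section LinearAlgebra.
Variable R : realType.
Implicit Types (V : 'M[R]_(4, 3)) (i j k : 'I_4) (x u v : 'rV[R]_3).

Lemma dotC u v : dot u v = dot v u.
Proof. by apply: eq_bigr => i _; rewrite mulrC. Qed.

Lemma dotDl u v x : dot (u + v) x = dot u x + dot v x.
Proof. by rewrite -big_split; apply: eq_bigr => i _; rewrite mxE mulrDl. Qed.

Lemma dotZl (a : R) u v : dot (a *: u) v = a * dot u v.
Proof. by rewrite mulr_sumr; apply: eq_bigr => i _; rewrite mxE mulrA. Qed.

Lemma dotDr u v x : dot x (u + v) = dot x u + dot x v.
Proof. by rewrite dotC dotDl !(dotC x). Qed.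

Lemma dotZr (a : R) u v : dot u (a *: v) = a * dot u v.
Proof. by rewrite dotC dotZl dotC. Qed.

Lemma dot0l u : dot 0 u = 0.
Proof. by rewrite -(scale0r 0) dotZl mul0r. Qed.

Lemma dotNl u v : dot (- u) v = - dot u v.
Proof. by rewrite -scaleN1r dotZl mulN1r. Qed.

Lemma dotNr u v : dot u (- v) = - dot u v.
Proof. by rewrite dotC dotNl dotC. Qed.

Lemma dotBl u v x : dot (u - v) x = dot u x - dot v x.
Proof. by rewrite dotDl dotNl. Qed.

Lemma dotBr u v x : dot x (u - v) = dot x u - dot x v.
Proof. by rewrite dotDr dotNr. Qed.

Lemma dot_suml (I : finType) (F : I -> 'rV[R]_3) u :
  dot (\sum_i F i) u = \sum_i dot (F i) u.
Proof.
by elim/big_ind2: _ => [|a b c d <- <-|//]; rewrite ?dot0l ?dotDl.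
Qed.

Lemma dot_ge0 u : 0 <= dot u u.
Proof. by apply: sumr_ge0 => i _; rewrite -expr2 sqr_ge0. Qed.

Lemma dot_eq0 u : (dot u u == 0) = (u == 0).
Proof.
apply/eqP/eqP => [|->]; last exact: dot0l.
move/psumr_eq0P => h; apply/rowP => i; rewrite mxE; apply/eqP.
by rewrite -sqrf_eq0 expr2 h // => j _; rewrite -expr2 sqr_ge0.
Qed.

Lemma dot_gt0 u : (0 < dot u u) = (u != 0).
Proof. by rewrite lt_def dot_ge0 andbT dot_eq0. Qed.

(* The rows are the vertices with a last coordinate 1, so that row vectors of
   weights act on this matrix as affine or as direction weights. *)
Definition vertex_mx V : 'M[R]_(3 + 1) := row_mx V (const_mx 1).

(** The top three entries of column [i] of the inverse of [vertex_mx V]; [offset] is the fourth. The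
    adjugate form shows rational dependence on the vertices, hence continuity. *)
Definition gradient V i : 'rV[R]_3 :=
  \row_j ((\det (vertex_mx V))^-1 * \adj (vertex_mx V) (lshift 1 j) i).

Definition offset V i : R :=
  (\det (vertex_mx V))^-1 * \adj (vertex_mx V) (rshift 3 ord0) i.

Definition bary V x i : R := dot x (gradient V i) + offset V i.

Definition gram V i j : R := dot (gradient V i) (gradient V j).

Lemma combinationE V (w : 'I_4 -> R) : combination V w = (\row_i w i) *m V.
Proof.
by rewrite mulmx_sum_row; apply: eq_bigr => i _; rewrite mxE.
Qed.

(** A left kernel vector of [vertex_mx V] is an affine dependency: the column of ones says that its
    weights sum to zero. *)
Lemma tetrahedronP V : reflect (tetrahedron V) (\det (vertex_mx V) != 0).
Proof.
apply: (iffP idP) => [dV w w0 Vw0 i|tV].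
  have : (\row_i w i : 'rV_(3 + 1)) = 0.
    apply: contraNeq dV => w_neq0; apply/det0P; exists (\row_i w i) => //.
    rewrite mul_mx_row -combinationE Vw0.
    suff -> : (\row_i w i : 'rV_4) *m const_mx 1 = (0 : 'rV[R]_1).
      by rewrite row_mx0.
    apply/rowP => j; rewrite !mxE -[RHS]w0.
    by apply: eq_bigr => k _; rewrite !mxE mulr1.
  by move/rowP/(_ i); rewrite !mxE.
apply/det0P => -[w /eqP w_neq0]; rewrite mul_mx_row -row_mx0.
move/eq_row_mx => [wV w1]; apply: w_neq0; apply/rowP => i; rewrite [RHS]mxE.
apply: (tV (fun i => w 0 i)).
  move/rowP/(_ 0): w1; rewrite !mxE => {2}<-.
  by apply: eq_bigr => k _; rewrite !mxE mulr1.
by rewrite combinationE -wV; congr (_ *m V); apply/rowP => j; rewrite mxE.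
Qed.

Lemma bary_vertex V : tetrahedron V ->
  forall i j, bary V (vertex V j) i = (j == i)%:R.
Proof.
move=> /tetrahedronP dV i j; rewrite /bary /offset.
have -> : (j == i)%:R =
    (\det (vertex_mx V))^-1 * (vertex_mx V *m \adj (vertex_mx V)) j i.
  by rewrite mul_mx_adj mxE mulrnAr mulVf.
rewrite [in RHS]mxE (@big_split_ord _ _ _ 3 1) /= mulrDr big_ord1.
rewrite row_mxEr [const_mx _ _ _]mxE mul1r; congr (_ + _).
rewrite mulr_sumr; apply: eq_bigr => k _.
by rewrite row_mxEl !mxE mulrCA.
Qed.

Lemma bary_affine V x u (s : R) i :
  bary V (x + s *: u) i = bary V x i + s * dot u (gradient V i).
Proof. by rewrite /bary dotDl dotZl addrAC. Qed.

Section Tetrahedron.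
Variables (V : 'M[R]_(4, 3)) (tV : tetrahedron V).

(** The barycentric coordinates are the row [(x, 1)] times the inverse of [vertex_mx V]. Multiplying
    back recovers [x] and the total weight 1 at once. *)
Lemma bary_row_mx x :
  row_mx (combination V (bary V x)) (const_mx (\sum_i bary V x i)) =
  row_mx x (const_mx 1 : 'rV_1).
Proof.
have dV := introT (tetrahedronP V) tV.
pose w : 'rV[R]_(3 + 1) := \row_i bary V x i.
have -> : row_mx (combination V (bary V x)) (const_mx (\sum_i bary V x i)) =
    w *m vertex_mx V.
  rewrite mul_mx_row combinationE; congr row_mx.
  apply/rowP => j; rewrite !mxE.
  by apply: eq_bigr => i _; rewrite !mxE mulr1.
have -> : w = (\det (vertex_mx V))^-1 *:
    (row_mx x (const_mx 1) *m \adj (vertex_mx V)).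
  apply/rowP => i; rewrite !mxE (@big_split_ord _ _ _ 3 1) /= mulrDr.
  rewrite big_ord1 row_mxEr [const_mx _ _ _]mxE mul1r; congr (_ + _).
  rewrite mulr_sumr; apply: eq_bigr => k _.
  by rewrite row_mxEl !mxE mulrCA.
by rewrite -scalemxAl -mulmxA mul_adj_mx mul_mx_scalar scalerA mulVf // scale1r.
Qed.

Lemma combination_bary x : combination V (bary V x) = x.
Proof. by have /eq_row_mx[] := bary_row_mx x. Qed.

Lemma sum_bary x : \sum_i bary V x i = 1.
Proof.
have /eq_row_mx[_] := bary_row_mx x.
by move=> /matrixP/(_ 0 0); rewrite !mxE.
Qed.

(** Serves two kinds of weights: direction weights, with sum 0, where the offset drops out, and
    affine weights, with sum 1, where [bary] adds it back. *)
Lemma dot_combination (w : 'I_4 -> R) i :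
  dot (combination V w) (gradient V i) = w i - offset V i * \sum_j w j.
Proof.
rewrite dot_suml; transitivity (\sum_j w j * ((j == i)%:R - offset V i)).
  by apply: eq_bigr => j _; rewrite dotZl -(bary_vertex tV) addrK.
rewrite mulr_sumr; under eq_bigr do rewrite mulrBr.
rewrite sumrB; congr (_ - _); last by apply: eq_bigr => j _; rewrite mulrC.
rewrite (bigD1 i) //= eqxx mulr1 big1 ?addr0 // => j /negPf ->.
by rewrite mulr0.
Qed.

Lemma bary_combination (w : 'I_4 -> R) i :
  \sum_j w j = 1 -> bary V (combination V w) i = w i.
Proof. by move=> w1; rewrite /bary dot_combination w1 mulr1 subrK. Qed.

Lemma dot_sum_gradient u : \sum_i dot u (gradient V i) = 0.
Proof.
have := sum_bary (0 + 1 *: u); under eq_bigr do rewrite bary_affine mul1r.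
by rewrite big_split /= sum_bary => /(canRL (addKr 1)); rewrite addNr.
Qed.

Lemma combination_gradient u :
  combination V (fun i => dot u (gradient V i)) = u.
Proof.
transitivity (combination V (bary V (0 + 1 *: u)) - combination V (bary V 0)).
  rewrite -sumrB; apply: eq_bigr => i _.
  by rewrite -scalerBl bary_affine mul1r [bary _ _ _ + _]addrC addrK.
by rewrite !combination_bary add0r scale1r subr0.
Qed.

Lemma dot_gradient_eq u v :
  (forall i, dot u (gradient V i) = dot v (gradient V i)) -> u = v.
Proof.
move=> uv; rewrite -[u]combination_gradient -[v]combination_gradient.
by apply: eq_bigr => i _; rewrite uv.
Qed.

Lemma bary_inj x y : (forall i, bary V x i = bary V y i) -> x = y.
Proof.
move=> xy; rewrite -[x]combination_bary -[y]combination_bary.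
by apply: eq_bigr => i _; rewrite xy.
Qed.

Lemma dot_gradient_edge i j k :
  dot (vertex V j - vertex V k) (gradient V i) = (j == i)%:R - (k == i)%:R.
Proof.
by rewrite dotBl -!(bary_vertex tV) /bary opprD addrACA subrr addr0.
Qed.

(** Each gradient combines the vertices with weights of sum zero, hence combines edges, so products
    with edges determine [u]. This is the tool for computing gradients of particular tetrahedra. *)
Lemma gradient_unique i u :
  (forall j k, dot (vertex V j - vertex V k) u = (j == i)%:R - (k == i)%:R) ->
  u = gradient V i.
Proof.
move=> hu; apply: dot_gradient_eq => l.
rewrite !(dotC _ (gradient V l)) -(combination_gradient (gradient V l)).
set w := fun j => _; have w0 : \sum_j w j = 0 by exact: dot_sum_gradient.
have h v : dot (combination V w) v = \sum_j w j * dot (vertex V j - vertex V i) v.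
  rewrite dot_suml; under eq_bigr do rewrite dotZl.
  under [RHS]eq_bigr do rewrite dotBl mulrBr.
  by rewrite sumrB -mulr_suml w0 mul0r subr0.
by rewrite !h; apply: eq_bigr => j _; rewrite hu dot_gradient_edge.
Qed.

Lemma gradient_neq0 i : gradient V i != 0.
Proof.
apply/eqP => g0; pose k := if i == 0 then 1 else 0 : 'I_4.
have := dot_gradient_edge i i k; rewrite g0 dotC dot0l eqxx.
have /negPf -> : k != i by rewrite /k; case: (eqVneq i 0) => [->|]//; rewrite eq_sym.
by move/eqP; rewrite subr0 eq_sym oner_eq0.
Qed.

Lemma gramC i j : gram V i j = gram V j i.
Proof. exact: dotC. Qed.

Lemma gram_gt0 i : 0 < gram V i i.
Proof. by rewrite /gram dot_gt0 gradient_neq0. Qed.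

Lemma sum_gram i : \sum_j gram V i j = 0.
Proof. exact: dot_sum_gradient. Qed.

Lemma orthogonal_gradient i : orthogonal_to_face V i (gradient V i).
Proof.
move=> j k /negPf ji /negPf ki.
by rewrite dotC dot_gradient_edge ji ki subr0.
Qed.

Lemma orthogonal_to_faceP i u :
  orthogonal_to_face V i u <-> exists a : R, u = a *: gradient V i.
Proof.
split=> [ou|[a ->] j k ji ki]; last by rewrite dotZl orthogonal_gradient ?mulr0.
pose p : 'I_4 := if i == 0 then 1 else 0.
have pi : p != i by rewrite /p; case: (eqVneq i 0) => [->|]//; rewrite eq_sym.
pose a := dot u (vertex V i - vertex V p).
have upq j : dot u (vertex V j - vertex V p) = a * (j == i)%:R.
  case: (eqVneq j i) => [->|ji]; first by rewrite mulr1.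
  by rewrite mulr0 ou.
(* If [a = 0], [u] is orthogonal to all edges and therefore to itself. Otherwise [a^-1 *: u] has the
   products with edges that characterize the gradient. *)
have [a0|a0] := eqVneq a 0.
  exists 0; rewrite scale0r; apply/eqP; rewrite -dot_eq0; apply/eqP.
  rewrite -{1}(combination_gradient u) dot_suml.
  transitivity (\sum_j dot u (gradient V j) * dot u (vertex V j - vertex V p)).
    under eq_bigr do rewrite dotZl (dotC (vertex V _)).
    under [RHS]eq_bigr do rewrite dotBr mulrBr.
    by rewrite sumrB -mulr_suml dot_sum_gradient mul0r subr0.
  by rewrite big1 // => j _; rewrite upq a0 mul0r mulr0.
exists a; rewrite -(@gradient_unique i (a^-1 *: u)) ?scalerA ?divff ?scale1r //.
move=> j k; rewrite dotZr dotC.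
have -> : vertex V j - vertex V k =
  (vertex V j - vertex V p) - (vertex V k - vertex V p).
  by rewrite opprB addrA subrK.
by rewrite dotBr !upq -mulrBr mulKf.
Qed.

Lemma reflectedP i u v : reflected V i u v <->
  v = u - (2 * dot u (gradient V i) / gram V i i) *: gradient V i.
Proof.
split=> [[n [n0 /orthogonal_to_faceP[a na] ->]]|->].
  have a0 : a != 0 by apply: contraNneq n0 => a0; rewrite na a0 scale0r.
  rewrite na dotZr dotZl dotZr scalerA -/(gram V i i); congr (_ - _ *: _).
  by field; rewrite a0 gt_eqF ?gram_gt0.
exists (gradient V i); split=> //; first exact: gradient_neq0.
exact: orthogonal_gradient.
Qed.

End Tetrahedron.
End LinearAlgebra.

(** * Combinatorics of the four labels *)

Lemma face_ind (P : 'I_4 -> Prop) :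
  P face_a -> P face_b -> P face_c -> P face_d -> forall i, P i.
Proof.
move=> Pa Pb Pc Pd [[|[|[|[|//]]]] i4].
- by rewrite (_ : Ordinal i4 = face_a) //; apply: val_inj.
- by rewrite (_ : Ordinal i4 = face_b) //; apply: val_inj.
- by rewrite (_ : Ordinal i4 = face_c) //; apply: val_inj.
- by rewrite (_ : Ordinal i4 = face_d) //; apply: val_inj.
Qed.

Lemma complementary_pair (i j : 'I_4) : i != j ->
  exists k l : 'I_4, k != l /\ pred2 k l =1 predC (pred2 i j).
Proof.
(* As a boolean test over the four labels, the claim is decided by computation in each of the
   sixteen cases. *)
suff h : exists k l : 'I_4, (i != j) ==>
    [&& k != l & all (fun n => pred2 k l n == ~~ pred2 i j n)
      [:: face_a; face_b; face_c; face_d]].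
  move=> ij; case: h => k [l]; rewrite ij => /andP[kl /= /and5P[]].
  move=> /eqP a /eqP b /eqP c /eqP d _.
  by exists k, l; split=> // n; elim/face_ind: n => /=.
by elim/face_ind: i; elim/face_ind: j;
  first [exists face_a, face_b; done | exists face_a, face_c; done
       | exists face_a, face_d; done | exists face_b, face_c; done
       | exists face_b, face_d; done | exists face_c, face_d; done].
Qed.

(** * The billiard map in barycentric coordinates *)

Section Billiard.
Variables (R : realType) (V : 'M[R]_(4, 3)) (tV : tetrahedron V).
Implicit Types (i j k : 'I_4) (x y u v m : 'rV[R]_3).

Lemma bary_continuous i : continuous (fun x => bary V x i).
Proof.
suff h : continuous (fun x => dot x (gradient V i)).
  by move=> x; exact: (cvgD (h x) (cvg_cst _)).
apply: (@continuous_big _ _ +%R) => [|j _ x]; first exact: add_continuous.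
exact: (cvgM (@coord_continuous _ _ _ _ _ x) (cvg_cst _)).
Qed.

Lemma convex_hullP (J : pred 'I_4) x : convex_hull V J x <->
  (forall i, 0 <= bary V x i) /\ (forall i, ~~ J i -> bary V x i = 0).
Proof.
split=> [[w [[w1 wJ] w0 ->]]|[x0 xJ]].
  by split=> i; rewrite bary_combination //; exact: wJ.
exists (bary V x); split=> //; last by rewrite combination_bary.
by split=> //; exact: sum_bary.
Qed.

Lemma solidP x : solid V x <-> forall i, 0 <= bary V x i.
Proof. by apply: (iff_trans (convex_hullP _ _)); split=> [[]|]. Qed.

Lemma faceP i x : face V i x <-> solid V x /\ bary V x i = 0.
Proof.
apply: (iff_trans (convex_hullP _ _)); split=> [[x0 xi]|[/solidP x0 xi]].
  split; first exact/solidP.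
  by apply: xi; rewrite /= negbK.
by split=> // j; rewrite /= negbK => /eqP ->.
Qed.

Lemma edgesP x : edges V x <->
  solid V x /\ exists i j, [/\ i != j, bary V x i = 0 & bary V x j = 0].
Proof.
split.
  move=> [i [j [ij /convex_hullP[x0 xij]]]]; split; first exact/solidP.
  have [k [l [kl klE]]] := complementary_pair ij.
  exists k, l; split=> //; apply: xij.
    by have := klE k; rewrite /= eqxx => <-.
  by have := klE l; rewrite /= eqxx orbT => <-.
move=> [/solidP x0 [i [j [ij xi xj]]]].
have [k [l [kl klE]]] := complementary_pair ij.
exists k, l; split=> //; apply/convex_hullP; split=> // n.
by rewrite klE /= negbK => /orP[] /eqP ->.
Qed.

Lemma interior_solidP x : interior (solid V) x <-> forall i, 0 < bary V x i.
Proof.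
split=> [xI i|x0]; last first.
  have : \forall y \near x, forall i, 0 < bary V y i.
    apply: (@filter_forall _ _ (fun i y => 0 < bary V y i) (nbhs x)) => i.
    exact: (cvgr_gt _ (@bary_continuous i x)).
  by apply: filterS => y y0; apply/solidP => i; exact: ltW.
(* Moving against the gradient lowers coordinate [i] at the positive rate [gram V i i]; remaining in
   the solid for a while forces that coordinate to be positive at [x]. *)
have : \forall s \near (0 : R), solid V (x - s *: gradient V i).
  suff h : (x - s *: gradient V i) @[s --> (0 : R)] --> x by exact: h.
  rewrite -{2}[x]subr0 -(scale0r (gradient V i)).
  apply: cvgB; first exact: cvg_cst.
  by apply: cvgZ; [exact: cvg_id|exact: cvg_cst].
move=> /nbhs_ballP[e /= e0 he].
have /he/solidP/(_ i) : ball (0 : R) e (e / 2).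
  by rewrite /ball /= sub0r normrN gtr0_norm ?divr_gt0 // ltr_pdivrMr // ltr_pMr ?ltr1n.
rewrite -scaleNr bary_affine mulNr subr_ge0; apply: lt_le_trans.
by rewrite mulr_gt0 ?divr_gt0 ?gram_gt0.
Qed.

Lemma closure_solid x : closure (solid V) x -> solid V x.
Proof.
move=> xC; apply/solidP => i; rewrite leNgt; apply/negP => xi.
have : \forall y \near x, bary V y i < 0.
  exact: (cvgr_lt _ (@bary_continuous i x)).
by move=> /xC[y [/solidP/(_ i)]]; rewrite /= leNgt => /negP.
Qed.

Lemma boundaryP x : boundary V x <-> solid V x /\ exists i, bary V x i = 0.
Proof.
split=> [[/closure_solid xS xNI]|[xS [i xi]]]; last first.
  split; first exact: subset_closure.
  by move=> /interior_solidP/(_ i); rewrite xi ltxx.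
split=> //; apply: contrapT => h; apply: xNI; apply/interior_solidP => i.
rewrite lt_def; move/solidP/(_ i): xS => ->; rewrite andbT.
by apply/eqP => xi; apply: h; exists i.
Qed.

Definition face_interior i x :=
  bary V x i = 0 /\ forall j, j != i -> 0 < bary V x j.

Lemma face_interior_solid i x : face_interior i x -> solid V x.
Proof.
move=> [xi xj]; apply/solidP => j.
by case: (eqVneq j i) => [->|/xj/ltW//]; rewrite xi.
Qed.

Lemma face_interiorP i x : face_interior i x <-> face V i x /\ ~ edges V x.
Proof.
split=> [xI|[/faceP[xS xi] xE]].
  split; first by apply/faceP; split; [exact: face_interior_solid xI|exact: xI.1].
  have [_ xj] := xI; move=> /edgesP[_ [j [k [jk j0 k0]]]].
  case: (eqVneq j i) => [ji|/xj]; last by rewrite j0 ltxx.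
  by have /xj : k != i by [rewrite -ji eq_sym]; rewrite k0 ltxx.
split=> // j ji; rewrite lt_def; move/solidP/(_ j): (xS) => ->; rewrite andbT.
by apply/eqP => xj; apply: xE; apply/edgesP; split=> //; exists j, i.
Qed.

Lemma face_interior_unique i j x :
  face_interior i x -> face V j x -> j = i.
Proof.
move=> [_ xj] /faceP[_ j0]; apply/eqP/negPn/negP => /xj.
by rewrite j0 ltxx.
Qed.

Lemma face_boundary i x : face V i x -> boundary V x.
Proof. by move=> /faceP[xS xi]; apply/boundaryP; split=> //; exists i. Qed.

(** Coordinates are affine along the flight and, as [i != j], none vanishes at both ends. So the
    open segment lies in the interior and [m'] is the first boundary point met. *)
Lemma billiard_map_intro i j m m' u u' (t : R) :
  i != j -> face_interior i m -> face_interior j m' ->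
  0 < t -> m' = m + t *: u -> enorm u = 1 -> reflected V j u u' ->
  billiard_map V (m, u) (m', u').
Proof.
move=> ij mi m'j t0 m'E u1 uu'.
have inside (s : R) : 0 < s < t -> forall k, 0 < bary V (m + s *: u) k.
  move=> /andP[s0 st] k.
  have -> : bary V (m + s *: u) k =
      (1 - s / t) * bary V m k + s / t * bary V m' k.
    by rewrite m'E !bary_affine; field; rewrite gt_eqF.
  have st1 : 0 < 1 - s / t by rewrite subr_gt0 ltr_pdivrMr ?mul1r.
  have st0 : 0 < s / t by rewrite divr_gt0.
  case: (eqVneq k i) => [->|ki].
    by rewrite mi.1 mulr0 add0r mulr_gt0 // m'j.2.
  rewrite ltr_pwDl ?mulr_gt0 // ?mi.2 // mulr_ge0 ?(ltW st0) //.
  by move/face_interior_solid/solidP: m'j => /(_ k).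
have [mF mE] := (face_interiorP i m).1 mi.
have [m'F m'E'] := (face_interiorP j m').1 m'j.
split=> //.
- split=> //; first exact: face_boundary mF.
  by exists t => // s st; apply/interior_solidP; exact: inside.
- exists t; split=> //; first exact: face_boundary m'F.
  by move=> s /inside h [_]; apply; apply/interior_solidP.
- by exists j.
Qed.

Lemma billiard_map_elim i j m m' u u' :
  billiard_map V (m, u) (m', u') -> face V i m -> face V j m' ->
  [/\ face_interior i m, face_interior j m', enorm u = 1, reflected V j u u' &
      exists2 t : R, 0 < t & m' = m + t *: u].
Proof.
move=> [[_ u1 _] [t [t0 m'E _ _]] [mE m'E'] [k m'k uu']] mi m'j.
have m'J : face_interior j m' by apply/face_interiorP.
split=> //; first exact/face_interiorP.
  by rewrite -(face_interior_unique m'J m'k).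
by exists t.
Qed.

(** The first hitting time is unique, and a hitting point on no edge lies on a single face, which
    fixes the reflection. *)
Lemma billiard_map_functional (x y y' : phase R) :
  billiard_map V x y -> billiard_map V x y' -> y = y'.
Proof.
case: x y y' => [m u] [m1 u1] [m2 u2].
move=> [_ [t1 [t10 m1E m1B h1]] [_ E1] [i F1 U1]].
move=> [_ [t2 [t20 m2E m2B h2]] [_ E2] [j F2 U2]].
have t12 : t1 = t2.
  apply/eqP; rewrite eq_le !leNgt; apply/andP; split; apply/negP => lt.
    by apply: (h1 t2); rewrite ?t20 // -m2E.
  by apply: (h2 t1); rewrite ?t10 // -m1E.
have m12 : m1 = m2 by rewrite m1E m2E t12.
rewrite -m12 in F2 *.
have ij : j = i := face_interior_unique ((face_interiorP i m1).2 (conj F1 E1)) F2.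
by subst j; congr pair; rewrite ((reflectedP tV i u u1).1 U1) ((reflectedP tV i u u2).1 U2).
Qed.

(** Labels are added modulo 4, so [k + 1] is the next letter of the word and the return after four
    bounces is built in. *)
Definition fagnano_polygon (m u : 'I_4 -> 'rV[R]_3) (t : 'I_4 -> R) :=
  forall k, [/\ face_interior k (m k), enorm (u k) = 1, 0 < t k,
    m (k + 1) = m k + t k *: u k & reflected V (k + 1) (u k) (u (k + 1))].

Lemma next_face :
  (((face_a + 1)%R = face_b) * ((face_b + 1)%R = face_c) *
   ((face_c + 1)%R = face_d) * ((face_d + 1)%R = face_a))%type.
Proof. by do ! split; apply: val_inj. Qed.

Lemma periodic_wordP : periodic_word V word_abcd <->
  exists (m u : 'I_4 -> 'rV[R]_3) (t : 'I_4 -> R), fagnano_polygon m u t.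
Proof.
split.
  move=> [[m0 u0] [[m1 u1] s0 [[m2 u2] s1 [[m3 u3] s2 [x4 s3 /= x4E]]]] code].
  subst x4.
  have [_ <- F0] := code 0 isT.
  (* Each [coding] clause brings its own iterates; functionality identifies them with the points of
     the given orbit. *)
  have [_ [_ /(billiard_map_functional s0) <- <- F1]] := code 1 isT.
  have [_ [_ /(billiard_map_functional s0) <-
    [_ /(billiard_map_functional s1) <- <- F2]]] := code 2 isT.
  have [_ [_ /(billiard_map_functional s0) <-
    [_ /(billiard_map_functional s1) <-
    [_ /(billiard_map_functional s2) <- <- F3]]]] := code 3 isT.
  have [I0 _ N0 R0 [t0 T0 E0]] := billiard_map_elim s0 F0 F1.
  have [I1 _ N1 R1 [t1 T1 E1]] := billiard_map_elim s1 F1 F2.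
  have [I2 _ N2 R2 [t2 T2 E2]] := billiard_map_elim s2 F2 F3.
  have [I3 _ N3 R3 [t3 T3 E3]] := billiard_map_elim s3 F3 F0.
  exists (fun k => nth 0 [:: m0; m1; m2; m3] k),
    (fun k => nth 0 [:: u0; u1; u2; u3] k), (fun k => nth 0 [:: t0; t1; t2; t3] k).
  by elim/face_ind; rewrite next_face.
move=> [m [u [t P]]].
have step k : billiard_map V (m k, u k) (m (k + 1), u (k + 1)).
  have [mk uk tk mE uE] := P k.
  apply: (@billiard_map_intro k (k + 1) _ _ _ _ (t k)) => //; last by have [] := P (k + 1).
  by rewrite -subr_eq0 opprD addNKr oppr_eq0; apply/eqP => /(congr1 val).
have F k : face V k (m k) by have [/face_interiorP[]] := P k.
have := step face_a; have := step face_b; have := step face_c.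
have := step face_d; rewrite !next_face => s3 s2 s1 s0.
exists (m face_a, u face_a).
  exists (m face_b, u face_b) => //; exists (m face_c, u face_c) => //.
  by exists (m face_d, u face_d) => //; exists (m face_a, u face_a).
move=> [|[|[|[|//]]]] _.
- by exists (m face_a, u face_a).
- by exists (m face_b, u face_b) => //; exists (m face_b, u face_b).
- exists (m face_c, u face_c) => //; exists (m face_b, u face_b) => //.
  by exists (m face_c, u face_c).
- exists (m face_d, u face_d) => //; exists (m face_b, u face_b) => //.
  by exists (m face_c, u face_c) => //; exists (m face_d, u face_d).
Qed.

End Billiard.

Lemma next4 (k : 'I_4) : k + 1 + 1 + 1 + 1 = k.
Proof. by elim/face_ind: k; rewrite !next_face. Qed.

Lemma sum_face (M : nmodType) (F : 'I_4 -> M) :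
  \sum_i F i = F face_a + F face_b + F face_c + F face_d.
Proof.
rewrite 3!big_ord_recl big_ord1 !addrA.
by congr (F _ + F _ + F _ + F _); apply: val_inj.
Qed.

Lemma next_neq (k : 'I_4) :
  ((((k + 1)%R == k) = false) * ((k == (k + 1)%R) = false) *
   (((k + 1 + 1)%R == k) = false) * ((k == (k + 1 + 1)%R) = false) *
   (((k + 1 + 1 + 1)%R == k) = false) * ((k == (k + 1 + 1 + 1)%R) = false))%type.
Proof. by elim/face_ind: k; rewrite !next_face. Qed.

(** * Closing equations *)

Section Equations.
Variables (R : realType) (V : 'M[R]_(4, 3)) (tV : tetrahedron V).
Implicit Types (i j k : 'I_4).

(** Up to a nonzero factor, the product with [gradient V k] of the relation saying that the four
    displacements [t k *: u k] sum to zero. *)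
Definition closing_equation (t : 'I_4 -> R) k : Prop :=
  gram V k k * (t (k + 1 + 1) + t (k + 1 + 1 + 1) - t k - t (k + 1)) +
  2 * gram V (k + 1 + 1 + 1) k * t (k + 1 + 1) -
  2 * gram V k (k + 1) * t (k + 1) = 0.

Lemma fagnano_closing m u t :
  fagnano_polygon V m u t -> forall k, closing_equation t k.
Proof.
(* [b k] is the multiple of [gradient V (k + 1)] added to the direction at the bounce on face
   [k + 1]. *)
move=> P; pose b k := - (2 * dot (u k) (gradient V (k + 1)) / gram V (k + 1) (k + 1)).
have uS k : u (k + 1) = u k + b k *: gradient V (k + 1).
  by have [_ _ _ _ /(reflectedP tV)] := P k; rewrite scaleNr.
(* The four increments of one period cancel; pairing their sum with the edge between the vertices
   [k + 1] and [k + 1 + 1] leaves only [b (k + 1) - b k]. *)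
have bS k : b (k + 1) = b k.
  have : b k *: gradient V (k + 1) + b (k + 1) *: gradient V (k + 1 + 1) +
      b (k + 1 + 1) *: gradient V (k + 1 + 1 + 1) +
      b (k + 1 + 1 + 1) *: gradient V (k + 1 + 1 + 1 + 1) = 0.
    by apply: (addrI (u k)); rewrite addr0 !addrA -!uS next4.
  move/(congr1 (dot (vertex V (k + 1 + 1) - vertex V (k + 1)))).
  rewrite !dotDr !dotZr !dot_gradient_edge // dotC dot0l.
  by elim/face_ind: k; rewrite !next_face /=; lra.
have bc k : b k = b face_a.
  have := (bS face_a, bS face_b, bS face_c); rewrite !next_face => -[[ab bc] cd].
  by elim/face_ind: k; rewrite // ?cd ?bc ab.
have ug k : 2 * dot (u k) (gradient V (k + 1)) =
    - b face_a * gram V (k + 1) (k + 1).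
  by rewrite -(bc k) /b; field; rewrite gt_eqF ?gram_gt0.
(* Otherwise the flight leaving face a would be parallel to face b: the coordinate of B would stay
   constant, yet it is positive at the start and zero at the end. *)
have b0 : b face_a != 0.
  apply/eqP => b0; have := ug face_a; rewrite b0 oppr0 mul0r => ug0.
  have [[_ xa] _ _ mS _] := P face_a; have [[xb _] _ _ _ _] := P (face_a + 1).
  have : 0 < bary V (m face_a) (face_a + 1) by apply: xa.
  have -> : bary V (m face_a) (face_a + 1) = 0; last by rewrite ltxx.
  rewrite -xb mS bary_affine.
  suff -> : dot (u face_a) (gradient V (face_a + 1)) = 0 by rewrite mulr0 addr0.
  by lra.
move=> k; apply: (mulfI b0); rewrite mulr0.
have mS l : m (l + 1) = m l + t l *: u l by have [] := P l.
have : t k *: u k + t (k + 1) *: u (k + 1) + t (k + 1 + 1) *: u (k + 1 + 1) +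
    t (k + 1 + 1 + 1) *: u (k + 1 + 1 + 1) = 0.
  by apply: (addrI (m k)); rewrite addr0 !addrA -!mS next4.
move/(congr1 (fun x => dot x (gradient V k))); rewrite !dotDl !dotZl dot0l.
have u3 := ug (k + 1 + 1 + 1); rewrite next4 in u3.
have u0 := uS (k + 1 + 1 + 1); rewrite next4 bc in u0.
move/(congr1 (fun x => dot x (gradient V k))): (u0).
have := congr1 (fun x => dot x (gradient V k)) (uS k).
have := congr1 (fun x => dot x (gradient V k)) (uS (k + 1 + 1)).
rewrite !bc !dotDl !dotZl -!/(gram V _ _) (gramC V (k + 1) k).
move: u3; set c := b face_a; set X3 := dot (u (k + 1 + 1 + 1)) (gradient V k).
set X2 := dot (u (k + 1 + 1)) _; set X1 := dot (u (k + 1)) (gradient V k).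
set X0 := dot (u k) (gradient V k); move=> e3 e2 e1 e0 e.
(* The bounce on face [k] reverses the component along its gradient and changes it by
   [c * gram V k k], which fixes [X3] and [X0]. One reflection forward from [X0] gives [X1], one
   backward from [X3] gives [X2]. *)
have X3E : X3 = - c * gram V k k / 2 by lra.
have X0E : X0 = c * gram V k k / 2 by lra.
have X1E : X1 = c * gram V k k / 2 + c * gram V k (k + 1) by lra.
have X2E : X2 = - c * gram V k k / 2 - c * gram V (k + 1 + 1 + 1) k by lra.
by move: e; rewrite X0E X1E X2E X3E => e; lra.
Qed.

(** * Nonexistence: right tetrahedra and a family of obtuse ones *)

Lemma periodic_closing : periodic_word V word_abcd ->
  exists t : 'I_4 -> R, (forall k, 0 < t k) /\ forall k, closing_equation t k.
Proof.
move/(periodic_wordP tV) => [m [u [t P]]]; exists t; split=> [k|].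
  by have [] := P k.
exact: fagnano_closing P.
Qed.

(** The edge from the right-angled vertex [i] to [j], divided by its squared length, is the gradient
    at [j], because it is orthogonal to the other edges at [i]. *)
Lemma right_gram i : (forall j k, j != i -> k != i -> j != k ->
    dot (vertex V j - vertex V i) (vertex V k - vertex V i) = 0) ->
  forall j k, j != i -> gram V j k = gram V j j * ((j == k)%:R - (i == k)%:R).
Proof.
move=> h j k ji; pose n := dot (vertex V j - vertex V i) (vertex V j - vertex V i).
have n0 : n != 0.
  rewrite dot_eq0; apply/eqP => /(congr1 (fun x => dot x (gradient V j))).
  rewrite dot_gradient_edge // dot0l eqxx (eq_sym i j) (negPf ji) subr0.
  by move/eqP; rewrite oner_eq0.
have gj : n^-1 *: (vertex V j - vertex V i) = gradient V j.
  apply: gradient_unique => // p q.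
  have hp l : dot (vertex V l - vertex V i) (vertex V j - vertex V i) =
      n * (l == j)%:R.
    case: (eqVneq l j) => [->|lj]; first by rewrite mulr1.
    case: (eqVneq l i) => [->|li]; last by rewrite mulr0 h.
    by rewrite subrr dot0l mulr0.
  have -> : vertex V p - vertex V q =
      (vertex V p - vertex V i) - (vertex V q - vertex V i).
    by rewrite opprB addrA subrK.
  by rewrite dotZr dotBl !hp -mulrBr mulKf.
have gE l : gram V j l = n^-1 * ((j == l)%:R - (i == l)%:R).
  by rewrite /gram -{1}gj dotZl dot_gradient_edge.
by rewrite gE [in RHS]gE eqxx (eq_sym i j) (negPf ji) subr0 mulr1.
Qed.

(** Divided by their diagonal Gram entries, the equations at the two faces following [i] differ only
    in the sign of [t (i + 1)], so this time would vanish. *)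
Lemma right_not_periodic :
  right_tetrahedron V -> ~ periodic_word V word_abcd.
Proof.
move=> [i /right_gram h] /periodic_closing[t [t0 eqn]].
have ni : i + 1 != i by rewrite next_neq.
have nni : i + 1 + 1 != i by rewrite next_neq.
have := eqn (i + 1); have := eqn (i + 1 + 1); rewrite /closing_equation !next4.
have g1 := gram_gt0 tV (i + 1); have g2 := gram_gt0 tV (i + 1 + 1).
rewrite (gramC V i) (h (i + 1) i) // (h (i + 1) (i + 1 + 1)) //.
rewrite (h (i + 1 + 1) (i + 1 + 1 + 1)) //.
rewrite !next_neq eqxx /= => e2 e1.
have f2 : t i + t (i + 1) - t (i + 1 + 1) - t (i + 1 + 1 + 1) = 0.
  by apply: (mulfI (lt0r_neq0 g2)); lra.
have f1 : t i - t (i + 1) - t (i + 1 + 1) - t (i + 1 + 1 + 1) = 0.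
  by apply: (mulfI (lt0r_neq0 g1)); lra.
by have := t0 (i + 1); lra.
Qed.

(** The hypothesis says that faces b and c meet at an obtuse dihedral angle. The projection of B on
    face b then has a negative coordinate at C, and in a right tetrahedron distinct gradients never
    have a positive product. *)
Lemma obtuse_gram : 0 < gram V face_b face_c -> obtuse V.
Proof.
move=> Gbc; split=> [/(_ face_b)[p [_ /(orthogonal_to_faceP tV)[a pE]]]|].
  move=> [w [[w1 wb] w0 pw]]; have wb0 := wb face_b isT.
  have e j : bary V (vertex V face_b) j - w j = a * gram V face_b j.
    rewrite -(bary_combination tV j w1) -pw /bary opprD addrACA subrr addr0.
    by rewrite -dotBl pE dotZl.
  have := e face_b; have := e face_c; rewrite !bary_vertex // wb0 eqxx /= => ec eb.
  have wc := w0 face_c isT; have gb := gram_gt0 tV face_b.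
  have a0 : 0 < a by rewrite -(pmulr_lgt0 a gb) -eb; lra.
  by have := mulr_gt0 a0 Gbc; lra.
move=> [i /right_gram h]; move: Gbc.
case: (eqVneq face_b i) => [bi|bi]; last first.
  rewrite (h face_b face_c bi) /= sub0r mulrN oppr_gt0.
  by rewrite ltNge mulr_ge0 ?ler0n // ltW ?gram_gt0.
rewrite (gramC V) (h face_c face_b) -?bi //= sub0r mulrN1 oppr_gt0.
by rewrite ltNge ltW ?gram_gt0.
Qed.

Lemma obtuse_not_periodic : 0 < gram V face_b face_c ->
  gram V face_c face_d * gram V face_b face_b <
    (gram V face_b face_c + gram V face_b face_d) * gram V face_c face_c ->
  ~ periodic_word V word_abcd.
Proof.
move=> Gbc Gcd /periodic_closing[t [t0 eqn]].
have := sum_gram tV face_b; rewrite sum_face (gramC V face_b face_a) => rb.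
have := eqn face_b; have := eqn face_c.
rewrite /closing_equation !next_face => ec eb.
have gb := gram_gt0 tV face_b; have gc := gram_gt0 tV face_c.
have ta := mulr_gt0 (mulr_gt0 Gbc gb) (t0 face_a).
have tb := mulr_gt0 (mulr_gt0 gb gc) (t0 face_b).
have tc := mulr_gt0 (mulr_gt0 Gbc gc) (t0 face_c).
(* Take [gram V face_b face_b] times the equation at c minus [gram V face_c face_c] times the one at
   b: the left-hand side is twice the sum of the positive terms of [ta], [tb], [tc] and [td]. The
   second hypothesis is the positivity of the coefficient of [t face_d]. *)
move: Gcd; rewrite -subr_gt0 => /mulr_gt0/(_ (t0 face_d)) td.
have rE : gram V face_a face_b =
  - gram V face_b face_b - gram V face_b face_c - gram V face_b face_d by lra.
rewrite rE in eb.
have := congr1 (fun z => gram V face_b face_b * z) ec.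
have := congr1 (fun z => gram V face_c face_c * z) eb.
rewrite /= !mulr0; lra.
Qed.

End Equations.

(** * Construction of the periodic orbit *)

Section Construction.
Variables (R : realType) (V : 'M[R]_(4, 3)) (tV : tetrahedron V).
Implicit Types (i j k : 'I_4).
Variable t : 'I_4 -> R.
Hypothesis t_gt0 : forall k, 0 < t k.
Hypothesis gram_next_gt0 : forall k,
  0 < gram V (k + 1) (k + 1) + 2 * gram V k (k + 1).
Hypothesis closing : forall k, closing_equation V t k.

(* Unnormalized barycentric coordinates of the k-th bounce and of the direction
   that leaves it. *)
Let weight k j : R :=
  if j == k then 0
  else if j == k + 1 then t k * gram V j j
  else if j == k + 1 + 1 then
    t (k + 1) * gram V j j + t k * (gram V j j + 2 * gram V (k + 1) j)
  else t j * gram V j j.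

Let slope k j : R :=
  if j == k then gram V j j
  else if j == k + 1 then - gram V j j
  else if j == k + 1 + 1 then - (gram V j j + 2 * gram V (k + 1) j)
  else gram V j j + 2 * gram V j k.

Let weightE k : [/\ weight k k = 0, weight k (k + 1) = t k * gram V (k + 1) (k + 1),
  weight k (k + 1 + 1) = t (k + 1) * gram V (k + 1 + 1) (k + 1 + 1) +
    t k * (gram V (k + 1 + 1) (k + 1 + 1) + 2 * gram V (k + 1) (k + 1 + 1)) &
  weight k (k + 1 + 1 + 1) =
    t (k + 1 + 1 + 1) * gram V (k + 1 + 1 + 1) (k + 1 + 1 + 1)].
Proof. by rewrite /weight !eqxx !next_neq. Qed.

Let slopeE k : [/\ slope k k = gram V k k,
  slope k (k + 1) = - gram V (k + 1) (k + 1),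
  slope k (k + 1 + 1) =
    - (gram V (k + 1 + 1) (k + 1 + 1) + 2 * gram V (k + 1) (k + 1 + 1)) &
  slope k (k + 1 + 1 + 1) =
    gram V (k + 1 + 1 + 1) (k + 1 + 1 + 1) + 2 * gram V (k + 1 + 1 + 1) k].
Proof. by rewrite /slope !eqxx !next_neq. Qed.

Lemma next_ind k (P : 'I_4 -> Prop) :
  P k -> P (k + 1) -> P (k + 1 + 1) -> P (k + 1 + 1 + 1) -> forall j, P j.
Proof.
by elim/face_ind: k; rewrite !next_face => P0 P1 P2 P3; elim/face_ind.
Qed.

Lemma sum_next k (F : 'I_4 -> R) :
  \sum_j F j = F k + F (k + 1) + F (k + 1 + 1) + F (k + 1 + 1 + 1).
Proof. by rewrite sum_face; elim/face_ind: k; rewrite !next_face; ring. Qed.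

Let row k : gram V k k + gram V k (k + 1) + gram V k (k + 1 + 1) +
  gram V k (k + 1 + 1 + 1) = 0.
Proof. by rewrite -sum_next sum_gram. Qed.

(** The sum is the combination of the four vanishing Gram row sums, from [k] on, with signs +, -, -,
    +. *)
Let sum_slope k : \sum_j slope k j = 0.
Proof.
rewrite (sum_next k); have [-> -> -> ->] := slopeE k.
have := (row k, row (k + 1), row (k + 1 + 1), row (k + 1 + 1 + 1)).
rewrite !next4 (gramC V (k + 1) k) (gramC V (k + 1 + 1) k).
rewrite (gramC V (k + 1 + 1 + 1) k) (gramC V (k + 1 + 1) (k + 1)).
rewrite (gramC V (k + 1 + 1 + 1) (k + 1)) (gramC V (k + 1 + 1 + 1) (k + 1 + 1)).
by move=> -[[[]]]; lra.
Qed.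

Let slope_next k j : slope (k + 1) j = slope k j + 2 * gram V (k + 1) j.
Proof.
have [p0 p1 p2 p3] := slopeE k; have := slopeE (k + 1).
rewrite !next4 => -[q1 q2 q3 q0].
elim/(@next_ind k): j; rewrite ?p0 ?p1 ?p2 ?p3 ?q0 ?q1 ?q2 ?q3 ?(gramC V (k + 1) k); try ring.
(* Three components agree identically; the one at [k + 1 + 1 + 1] uses the vanishing of a Gram row
   sum. *)
have := row (k + 1 + 1 + 1); rewrite !next4.
rewrite (gramC V (k + 1 + 1 + 1) (k + 1)) (gramC V (k + 1 + 1 + 1) (k + 1 + 1)).
lra.
Qed.

Let weight_next k j : weight (k + 1) j = weight k j + t k * slope k j.
Proof.
have [p0 p1 p2 p3] := slopeE k; have [w0 w1 w2 w3] := weightE k.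
have := weightE (k + 1); rewrite !next4 => -[v1 v2 v3 v0].
elim/(@next_ind k): j; rewrite ?p0 ?p1 ?p2 ?p3 ?w0 ?w1 ?w2 ?w3 ?v0 ?v1 ?v2 ?v3; try ring.
(* The remaining component, at [k + 1 + 1 + 1], is exactly a closing equation. *)
have := closing (k + 1 + 1 + 1); rewrite /closing_equation !next4; lra.
Qed.

(** Since slopes sum to zero, all bounces have the same total weight [S], and dividing by [S] gives
    barycentric coordinates. They are positive off the bounced face thanks to [gram_next_gt0]. *)
Lemma fagnano_construction : periodic_word V word_abcd.
Proof.
pose S := \sum_j weight face_a j.
have weight_gt0 k j : j != k -> 0 < weight k j.
  have [w0 w1 w2 w3] := weightE k.
  elim/(@next_ind k): j; rewrite ?eqxx ?w1 ?w2 ?w3 // => _.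
  - by rewrite mulr_gt0 ?gram_gt0.
  - by rewrite addr_gt0 ?mulr_gt0 ?gram_gt0 ?gram_next_gt0.
  - by rewrite mulr_gt0 ?gram_gt0.
have sum_weight k : \sum_j weight k j = S.
  have SS l : \sum_j weight (l + 1) j = \sum_j weight l j.
    under eq_bigr do rewrite weight_next.
    by rewrite big_split /= -mulr_sumr sum_slope mulr0 addr0.
  have := (SS face_a, SS face_b, SS face_c); rewrite !next_face => -[[ab bc] cd].
  by elim/face_ind: k; rewrite // ?cd ?bc ab.
have S0 : 0 < S.
  rewrite -(sum_weight face_a) (sum_next face_a).
  have [w0 _ _ _] := weightE face_a; rewrite w0 add0r.
  by do 2 ?apply: addr_gt0; apply: weight_gt0; rewrite next_neq.
pose U k := combination V (slope k).
have Ug k j : dot (U k) (gradient V j) = slope k j.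
  by rewrite dot_combination // sum_slope mulr0 subr0.
have US k : U (k + 1) = U k + 2 *: gradient V (k + 1).
  by apply: (dot_gradient_eq tV) => j; rewrite dotDl dotZl !Ug slope_next.
pose L2 := dot (U face_a) (U face_a).
(* Adding twice the gradient preserves the length because the product of [U l] with that gradient is
   minus its squared norm. *)
have UU k : dot (U k) (U k) = L2.
  have SS l : dot (U (l + 1)) (U (l + 1)) = dot (U l) (U l).
    have [_ s1 _ _] := slopeE l.
    rewrite US !(dotDl, dotDr, dotZl, dotZr) (dotC _ (U l)) Ug s1 -/(gram V _ _).
    by ring.
  have := (SS face_a, SS face_b, SS face_c); rewrite !next_face => -[[ab bc] cd].
  by elim/face_ind: k; rewrite // ?cd ?bc ab.
have L0 : 0 < L2.
  rewrite dot_gt0; apply/eqP => /(congr1 (fun x => dot x (gradient V face_a))).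
  have [s0 _ _ _] := slopeE face_a; rewrite Ug s0 dot0l => g0.
  by have := gram_gt0 tV face_a; rewrite g0 ltxx.
pose L := Num.sqrt L2; have L_gt0 : 0 < L by rewrite sqrtr_gt0.
apply/(periodic_wordP tV).
(* Positions shrink by [S] and directions by [L], so the times are rescaled by [L / S]. *)
exists (fun k => combination V (fun j => weight k j / S)), (fun k => L^-1 *: U k),
  (fun k => t k * L / S).
have bw k j : bary V (combination V (fun j => weight k j / S)) j = weight k j / S.
  by rewrite bary_combination // -mulr_suml sum_weight divff ?gt_eqF.
move=> k; split.
- split=> [|j jk]; rewrite bw; last by rewrite divr_gt0 ?weight_gt0.
  by have [-> _ _ _] := weightE k; rewrite mul0r.
- rewrite /enorm dotZl dotZr UU -[L2]sqr_sqrtr ?ltW // -/L.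
  by rewrite (_ : _ * _ = 1) ?sqrtr1 //; field; rewrite gt_eqF.
- by rewrite divr_gt0 // mulr_gt0.
- apply: (bary_inj tV) => j; rewrite bary_affine !bw dotZl Ug weight_next.
  by field; rewrite !gt_eqF.
- apply/(reflectedP tV); apply: (dot_gradient_eq tV) => j.
  rewrite dotBl !dotZl !Ug slope_next -/(gram V _ _).
  have [_ -> _ _] := slopeE k.
  by field; rewrite !gt_eqF ?gram_gt0.
Qed.

End Construction.

(** * Times of flight by Cramer's rule *)

Section ClosingTimes.
Variable R : realType.
Implicit Types (V : 'M[R]_(4, 3)) (i j k : 'I_4).

Definition det3 (a b c d e f g h i : R) : R :=
  a * (e * i - f * h) - b * (d * i - f * g) + c * (d * h - e * g).

(* Coefficients of the closing equation at k. Those at d are minus the sums of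
   those at a, b and c, so the 3 x 3 minors of these three rows give a solution. *)
Definition closing_row V k l : R :=
  if l == k then - gram V k k
  else if l == k + 1 then - gram V k k - 2 * gram V k (k + 1)
  else if l == k + 1 + 1 then gram V k k + 2 * gram V (k + 1 + 1 + 1) k
  else gram V k k.

Definition closing_minor V k l m : R :=
  let r := closing_row V in
  det3 (r face_a k) (r face_a l) (r face_a m)
       (r face_b k) (r face_b l) (r face_b m)
       (r face_c k) (r face_c l) (r face_c m).

Definition closing_times V k : R :=
  if k == face_a then closing_minor V face_b face_c face_d
  else if k == face_b then - closing_minor V face_a face_c face_d
  else if k == face_c then closing_minor V face_a face_b face_d
  else - closing_minor V face_a face_b face_c.

Lemma closing_row_sum V k (t : 'I_4 -> R) :
  closing_equation V t k <-> \sum_l closing_row V k l * t l = 0.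
Proof.
rewrite /closing_equation (sum_next k) /closing_row !eqxx !next_neq.
by split=> <-; ring.
Qed.

(** The four coefficients of the time [t l] are, up to sign, the components of [slope l], which sum
    to zero. *)
Lemma closing_row_d V : tetrahedron V -> forall l, closing_row V face_d l =
  - (closing_row V face_a l + closing_row V face_b l + closing_row V face_c l).
Proof.
move=> tV; have := (sum_gram tV face_a, sum_gram tV face_b, sum_gram tV face_c,
  sum_gram tV face_d); rewrite !sum_face.
rewrite (gramC V face_b face_a) (gramC V face_c face_a) (gramC V face_d face_a).
rewrite (gramC V face_c face_b) (gramC V face_d face_b) (gramC V face_d face_c).
move=> -[[[ra rb] rc] rd].
elim/face_ind; rewrite /closing_row !next_face /=
  ?(gramC V face_d face_a) ?(gramC V face_b face_a); lra.
Qed.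

(** At a, b and c the left-hand side expands a 4 x 4 determinant with a repeated row; the row at d
    depends linearly on the others. *)
Lemma closing_times_eq V : tetrahedron V ->
  forall k, closing_equation V (closing_times V) k.
Proof.
move=> tV k; apply/closing_row_sum; rewrite sum_face.
have rd := closing_row_d tV.
elim/face_ind: k; rewrite ?rd /closing_times /= /closing_minor /det3; ring.
Qed.

End ClosingTimes.

(** * Continuity in the vertices *)

Section Continuity.
Variables (R : realType) (T : Type) (F : set_system T).
Context {FF : Filter F}.
Implicit Types (i j k : 'I_4).

Lemma det_cvg (n : nat) (A : T -> 'M[R]_n) (B : 'M[R]_n) :
  (forall i j : 'I_n, A x i j @[x --> F] --> B i j) ->
  \det (A x) @[x --> F] --> \det B.
Proof.
move=> AB; apply: cvg_big => [|s _]; first exact: add_continuous.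
apply: cvgM; first exact: cvg_cst.
by apply: cvg_big => [|i _]; [exact: mul_continuous|exact: AB].
Qed.

Variables (W : T -> 'M[R]_(4, 3)) (V : 'M[R]_(4, 3)).
Hypothesis WV : forall i (j : 'I_3), W x i j @[x --> F] --> V i j.

Lemma vertex_mx_cvg (i j : 'I_(3 + 1)) :
  vertex_mx (W x) i j @[x --> F] --> vertex_mx V i j.
Proof.
case: (@split_ordP 3 1 j) => j' ->.
  by rewrite row_mxEl; under eq_cvg do rewrite row_mxEl; exact: WV.
have e (U : 'M[R]_(4, 3)) : vertex_mx U i (rshift 3 j') = 1.
  by rewrite row_mxEr mxE.
have -> : (fun x => vertex_mx (W x) i (rshift 3 j')) = (fun=> 1).
  by apply: funext => x; exact: e.
by rewrite e; exact: cvg_cst.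
Qed.

Lemma det_vertex_mx_cvg :
  \det (vertex_mx (W x)) @[x --> F] --> \det (vertex_mx V).
Proof. by apply: det_cvg => i j; exact: vertex_mx_cvg. Qed.

Lemma near_tetrahedron : tetrahedron V -> \forall x \near F, tetrahedron (W x).
Proof.
move=> /tetrahedronP dV.
have : \forall x \near F, \det (vertex_mx (W x)) != 0.
  exact: (cvgr_neq0 _ det_vertex_mx_cvg).
by apply: filterS => x dW; exact/tetrahedronP.
Qed.

Hypothesis tV : tetrahedron V.

(** Each entry is a signed minor of [vertex_mx] over its determinant, which does not vanish at the
    limit. *)
Lemma gradient_cvg i (j : 'I_3) :
  gradient (W x) i 0 j @[x --> F] --> gradient V i 0 j.
Proof.
have e (U : 'M[R]_(4, 3)) : gradient U i 0 j = (\det (vertex_mx U))^-1 *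
    ((-1) ^+ (i + lshift 1 j) *
      \det (row' i (col' (lshift 1 j) (vertex_mx U)))) by rewrite !mxE.
have -> := funext (fun x => e (W x)).
rewrite e; apply: cvgM.
  by apply: cvgV; [exact/tetrahedronP|exact: det_vertex_mx_cvg].
apply: cvgM; first exact: cvg_cst.
apply: det_cvg => k l.
have f (U : 'M[R]_(4, 3)) : row' i (col' (lshift 1 j) (vertex_mx U)) k l =
  vertex_mx U (lift i k) (lift (lshift 1 j) l) by rewrite !mxE.
have -> := funext (fun x => f (W x)).
by rewrite f; exact: vertex_mx_cvg.
Qed.

Lemma gram_cvg i j : gram (W x) i j @[x --> F] --> gram V i j.
Proof.
apply: cvg_big => [|k _]; first exact: add_continuous.
by apply: cvgM; exact: gradient_cvg.
Qed.


Lemma det3_cvg (a b c d e f g h i : T -> R) (a' b' c' d' e' f' g' h' i' : R) :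
  a x @[x --> F] --> a' -> b x @[x --> F] --> b' -> c x @[x --> F] --> c' ->
  d x @[x --> F] --> d' -> e x @[x --> F] --> e' -> f x @[x --> F] --> f' ->
  g x @[x --> F] --> g' -> h x @[x --> F] --> h' -> i x @[x --> F] --> i' ->
  det3 (a x) (b x) (c x) (d x) (e x) (f x) (g x) (h x) (i x) @[x --> F] -->
  det3 a' b' c' d' e' f' g' h' i'.
Proof.
move=> ha hb hc hd he hf hg hh hi.
apply: cvgD; first apply: cvgB.
- by apply: cvgM => //; apply: cvgB; exact: cvgM.
- by apply: cvgM => //; apply: cvgB; exact: cvgM.
- by apply: cvgM => //; apply: cvgB; exact: cvgM.
Qed.


Lemma closing_row_cvg k l :
  closing_row (W x) k l @[x --> F] --> closing_row V k l.
Proof.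
rewrite /closing_row; do 3 ?case: ifP => _; last exact: gram_cvg.
- by apply: cvgN; exact: gram_cvg.
- by apply: cvgB; [apply: cvgN|apply: cvgM; first exact: cvg_cst]; exact: gram_cvg.
- by apply: cvgD; [|apply: cvgM; first exact: cvg_cst]; exact: gram_cvg.
Qed.

Lemma closing_times_cvg k :
  closing_times (W x) k @[x --> F] --> closing_times V k.
Proof.
have mc p q r : closing_minor (W x) p q r @[x --> F] --> closing_minor V p q r.
  by apply: det3_cvg; exact: closing_row_cvg.
elim/face_ind: k.
- exact: (mc face_b face_c face_d).
- exact: (cvgN (mc face_a face_c face_d)).
- exact: (mc face_a face_b face_d).
- exact: (cvgN (mc face_a face_b face_c)).
Qed.

Lemma gram_next_cvg k :
  gram (W x) (k + 1) (k + 1) + 2 * gram (W x) k (k + 1) @[x --> F] -->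
  gram V (k + 1) (k + 1) + 2 * gram V k (k + 1).
Proof.
by apply: cvgD; [|apply: cvgM; first exact: cvg_cst]; exact: gram_cvg.
Qed.

Lemma obtuse_region_cvg :
  (gram (W x) face_b face_c + gram (W x) face_b face_d) * gram (W x) face_c face_c -
    gram (W x) face_c face_d * gram (W x) face_b face_b @[x --> F] -->
  (gram V face_b face_c + gram V face_b face_d) * gram V face_c face_c -
    gram V face_c face_d * gram V face_b face_b.
Proof.
by apply: cvgB; apply: cvgM; [apply: cvgD| | |]; exact: gram_cvg.
Qed.

End Continuity.

(** * Regular tetrahedra, and an open region of obtuse ones *)

Section Conclusion.
Variable R : realType.
Implicit Types (V : 'M[R]_(4, 3)) (i j k : 'I_4).

Let id_cvg V i (j : 'I_3) : (fun W : 'M[R]_(4, 3) => W i j) @ V --> V i j.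
Proof. exact: coord_continuous. Qed.

Lemma regular_gram V : regular V -> exists2 e : R, 0 < e &
  forall i j, gram V i j = e * (4 * (i == j)%:R - 1).
Proof.
move=> [tV reg].
pose s := dot (vertex V face_a - vertex V face_b) (vertex V face_a - vertex V face_b).
have edge i j : dot (vertex V i - vertex V j) (vertex V i - vertex V j) =
    s * (i != j)%:R.
  case: (eqVneq i j) => [->|ij]; first by rewrite subrr dot0l mulr0.
  rewrite mulr1 -[LHS]sqr_sqrtr ?dot_ge0 // -[RHS]sqr_sqrtr ?dot_ge0 //.
  by congr (_ ^+ 2); exact: reg.
have s0 : 0 < s.
  rewrite dot_gt0; apply/eqP => /(congr1 (fun x => dot x (gradient V face_a))).
  by rewrite dot_gradient_edge // dot0l /= subr0 => /eqP; rewrite oner_eq0.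
(* Polarization: the product of two edges is half a signed sum of four squared lengths. *)
have cross i j k l : dot (vertex V j - vertex V k) (vertex V i - vertex V l) =
    s / 2 * ((j != l)%:R + (k != i)%:R - (j != i)%:R - (k != l)%:R).
  have := (edge j l, edge k i, edge j i, edge k l).
  rewrite !(dotBl, dotBr) (dotC (vertex V l) (vertex V j)).
  rewrite (dotC (vertex V i) (vertex V k)) (dotC (vertex V i) (vertex V j)).
  rewrite (dotC (vertex V l) (vertex V k)).
  by move=> -[[[]]]; lra.
(* By symmetry the altitude from vertex [i] has the direction of the sum of the edges ending there;
   pairing it with an edge at [i] fixes the factor. *)
have gE i : (2 * s)^-1 *: \sum_l (vertex V i - vertex V l) = gradient V i.
  apply: (gradient_unique tV) => j k; rewrite dotZr dotC dot_suml.
  under eq_bigr do rewrite dotC cross.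
  have neq3 (p : 'I_4) : (p != face_a)%:R + (p != face_b)%:R +
      (p != face_c)%:R + (p != face_d)%:R = 3 :> R.
    by elim/face_ind: p => /=; ring.
  have neqE (p q : 'I_4) : (p != q)%:R = 1 - (p == q)%:R :> R.
    by case: eqVneq => _; rewrite ?subrr ?subr0.
  rewrite -mulr_sumr sum_face [X in _ * (_ * X)](_ : _ =
    4 * ((k != i)%:R - (j != i)%:R)); last by have := (neq3 j, neq3 k) => -[]; lra.
  by rewrite !neqE; field; rewrite gt_eqF.
exists (2 * s)^-1 => [|i j]; first by rewrite invr_gt0 mulr_gt0.
rewrite /gram -{1}gE dotZl dot_suml; congr (_ * _).
under eq_bigr do rewrite dot_gradient_edge //.
by rewrite sum_face; elim/face_ind: j; rewrite /=; ring.
Qed.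

Lemma regular_periodic V : regular V ->
  \forall W \near V, tetrahedron W -> periodic_word W word_abcd.
Proof.
move=> rV; have tV := rV.1; have [e e0 gE] := regular_gram rV.
have near_times : \forall W \near V, forall k, 0 < closing_times W k.
  apply: (@filter_forall _ _ (fun k W => 0 < closing_times W k) (nbhs V)) => k.
  have tc : closing_times W k @[W --> V] --> closing_times V k.
    exact: (closing_times_cvg (@id_cvg V) tV).
  apply: (cvgr_gt _ tc).
  (* Diagonal Gram entries are [3 * e] and the others [- e]; all four signed minors then take this
     common value. *)
  have -> : closing_times V k = 32 * e ^+ 3; last by rewrite mulr_gt0 ?exprn_gt0.
  rewrite /closing_times /closing_minor /closing_row /det3 !gE !next_face.
  by elim/face_ind: k {tc} => /=; ring.
have near_gram : \forall W \near V, forall k,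
    0 < gram W (k + 1) (k + 1) + 2 * gram W k (k + 1).
  apply: (@filter_forall _ _ (fun k W =>
    0 < gram W (k + 1) (k + 1) + 2 * gram W k (k + 1)) (nbhs V)) => k.
  have gc : gram W (k + 1) (k + 1) + 2 * gram W k (k + 1) @[W --> V] -->
      gram V (k + 1) (k + 1) + 2 * gram V k (k + 1).
    exact: (gram_next_cvg (@id_cvg V) tV).
  apply: (cvgr_gt _ gc); rewrite !gE eqxx next_neq /=.
  by rewrite (_ : _ + _ = e) //; ring.
near=> W => tW; apply: (fagnano_construction tW (t := closing_times W)).
- by near: W.
- by near: W.
- exact: closing_times_eq.
Unshelve. all: by end_near.
Qed.

Definition obtuse_region : set 'M[R]_(4, 3) :=
  [set V | [/\ tetrahedron V, 0 < gram V face_b face_c &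
    gram V face_c face_d * gram V face_b face_b <
    (gram V face_b face_c + gram V face_b face_d) * gram V face_c face_c]].

Lemma open_obtuse_region : open obtuse_region.
Proof.
rewrite openE => V [tV Gbc Gcd]; have gc := gram_cvg (FF := nbhs_filter V) (@id_cvg V) tV.
have fc := obtuse_region_cvg (FF := nbhs_filter V) (@id_cvg V) tV.
rewrite -subr_gt0 in Gcd.
have near1 := cvgr_gt (FF := nbhs_filter V) _ (gc face_b face_c) _ Gbc.
have near2 := cvgr_gt (FF := nbhs_filter V) _ fc _ Gcd.
have near3 := near_tetrahedron (FF := nbhs_filter V) (@id_cvg V) tV.
apply: (@filterS3 _ (nbhs V) (nbhs_filter V)) near1 near2 near3 => W W1 W2 W3.
by split=> //; rewrite -subr_gt0.
Qed.

Definition row3 (x y z : R) : 'rV[R]_3 := \row_i nth 0 [:: x; y; z] i.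

Lemma dot_row3 x y z x' y' z' :
  dot (row3 x y z) (row3 x' y' z') = x * x' + y * y' + z * z'.
Proof. by rewrite /dot !big_ord_recl big_ord0 !mxE /= addr0 addrA. Qed.

Lemma obtuse_region_neq0 : obtuse_region !=set0.
Proof.
(* With A at the origin, [g] lists the dual basis of B, C, D, preceded by minus its sum. The
   relevant Gram entries are 1 for bc and bb, 2 for cc, and 0 for bd and cd. *)
pose v k := nth 0 [:: 0; row3 1 (-1) 0; row3 0 1 0; row3 0 0 1] k.
pose g k := nth 0 [:: row3 (-2) (-1) (-1); row3 1 0 0; row3 1 1 0; row3 0 0 1] k.
pose V : 'M[R]_(4, 3) := \matrix_i v i.
have vE i : vertex V i = v i by rewrite /vertex rowK.
have vg i j : dot (v i) (g j) = (i == j)%:R - (face_a == j)%:R.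
  by elim/face_ind: i; elim/face_ind: j; rewrite ?dot0l ?dot_row3 /=; ring.
have tV : tetrahedron V.
  move=> w w0 Vw i.
  have h j : dot (combination V w) (g j) = w j.
    rewrite dot_suml; under eq_bigr do rewrite dotZl vE vg mulrBr.
    rewrite sumrB -mulr_suml w0 mul0r subr0 (bigD1 j) //= eqxx mulr1.
    by rewrite big1 ?addr0 // => k /negPf ->; rewrite mulr0.
  by rewrite -h Vw dot0l.
have gE k : gradient V k = g k.
  apply/esym/gradient_unique => // i j.
  by rewrite !vE dotBl !vg opprB addrA subrK.
exists V; split=> //; rewrite /gram !gE /g /= !dot_row3; lra.
Qed.

End Conclusion.

Theorem theorem2 (R : realType) :
  (forall V0 : 'M[R]_(4, 3), regular V0 ->
     \forall V \near V0, tetrahedron V -> periodic_word V word_abcd) /\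
  (forall V : 'M[R]_(4, 3), tetrahedron V -> right_tetrahedron V ->
     ~ periodic_word V word_abcd) /\
  (exists U : set 'M[R]_(4, 3),
     [/\ open U, U !=set0,
         forall V, U V -> tetrahedron V /\ obtuse V &
         forall V, U V -> ~ periodic_word V word_abcd]).
Proof.
split; first exact: regular_periodic.
split; first exact: right_not_periodic.
exists (@obtuse_region R); split=> [||V [tV Gbc _]|V [tV Gbc Gcd]].
- exact: open_obtuse_region.
- exact: obtuse_region_neq0.
- by split=> //; exact: obtuse_gram.
- exact: obtuse_not_periodic.
Qed.
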